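(* Let $\widetilde{\mathscr{C}}$ be the empirical GraField kernel of a graph $\mathcal G$ on $n$ vertices. Let $u_0=0$, $u_j=\sum_{x\le j}\widetilde p(x)$, and let $\eta_j(u)=1$ for $u_{j-1}<u\le u_j$ and $\eta_j(u)=0$ otherwise ($j=1,\dots,n$), so that $\int_0^1\eta_j(u)\,du=\int_0^1\eta_j^2(u)\,du=\widetilde p(j)$. For $\alpha\in\mathbb R^n$ and $\lambda\in\mathbb R$, the estimating equations $$\sum_{j=1}^n\alpha_j\iint_{[0,1]^2}\big(\widetilde{\mathscr{C}}(u,v)-1\big)\eta_j(v)\eta_k(u)\,dv\,du-\lambda\sum_{j=1}^n\alpha_j\int_0^1\eta_j(u)\eta_k(u)\,du=0,\qquad k=1,\dots,n,$$ hold if and only if $$\mathcal B\,\alpha=\lambda\,D\,\alpha,\qquad \mathcal B=A-N^{-1}dd^{T}.$$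
   Context: $\mathcal G$ is an undirected, possibly weighted, graph with vertex set $\{1,\dots,n\}$ and symmetric adjacency matrix $A$ with nonnegative entries; $d_x=\sum_yA(x,y)>0$ is the degree of $x$; $d=(d_1,\dots,d_n)^T$; $D=\mathrm{diag}(d_1,\dots,d_n)$; $N=\sum_{x,y}A(x,y)$. The empirical estimates are $\widetilde P(x,y)=A(x,y)/N$ and $\widetilde p(x)=d_x/N$. With $F(x)=\sum_{y\le x}\widetilde p(y)$ and $Q(u)=\min\{x:F(x)\ge u\}$ for $0<u<1$, the empirical GraField kernel is $\widetilde{\mathscr{C}}(u,v)=\widetilde P(Q(u),Q(v))/\big(\widetilde p(Q(u))\widetilde p(Q(v))\big)$, $0<u,v<1$. The estimating equations are the Galerkin equations for approximating a solution $\phi$ of $\int_0^1[\widetilde{\mathscr{C}}(u,v)-1]\phi(v)\,dv=\lambda\phi(u)$ by $\phi=\sum_j\alpha_j\eta_j$. The matrix $\mathcal B$ is the modularity matrix. *)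

(* Defs.v *)
From HB Require Import structures.
From mathcomp Require Import all_boot all_order all_algebra.
From mathcomp Require Import all_classical all_reals all_analysis.

Set Implicit Arguments.
Unset Strict Implicit.
Unset Printing Implicit Defensive.

Import Order.TTheory GRing.Theory Num.Theory.
Import numFieldNormedType.Exports.

Local Open Scope classical_set_scope.
Local Open Scope ring_scope.

(* A weighted graph on a nonempty vertex set is given by its adjacency matrix
   A : 'M[R]_n.+1; vertices are numbered from 0 to n. *)

Definition degree (R : realType) (n : nat) (A : 'M[R]_n.+1) : 'cV[R]_n.+1 :=
  \col_x \sum_y A x y.

Definition degree_mx (R : realType) (n : nat) (A : 'M[R]_n.+1) : 'M[R]_n.+1 :=
  diag_mx (degree A)^T.

Definition volume (R : realType) (n : nat) (A : 'M[R]_n.+1) : R :=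
  \sum_x \sum_y A x y.

Definition modularity_mx (R : realType) (n : nat) (A : 'M[R]_n.+1) :
    'M[R]_n.+1 :=
  A - (volume A)^-1 *: (degree A *m (degree A)^T).

Definition joint_prob (R : realType) (n : nat) (A : 'M[R]_n.+1)
    (x y : 'I_n.+1) : R :=
  A x y / volume A.

Definition vertex_prob (R : realType) (n : nat) (A : 'M[R]_n.+1)
    (x : 'I_n.+1) : R :=
  degree A x 0 / volume A.

Definition vertex_cdf (R : realType) (n : nat) (A : 'M[R]_n.+1)
    (x : 'I_n.+1) : R :=
  \sum_(y < n.+1 | (y <= x)%N) vertex_prob A y.

(* The smallest x with u <= vertex_cdf A x. The default ord_max satisfies this
   condition when u <= 1; only for u > 1 is the value a convention. *)
Definition vertex_quantile (R : realType) (n : nat) (A : 'M[R]_n.+1) (u : R) :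
    'I_n.+1 :=
  [arg min_(x < (ord_max : 'I_n.+1) | (u <= vertex_cdf A x)%R) x]%O.

Definition grafield_kernel (R : realType) (n : nat) (A : 'M[R]_n.+1)
    (u v : R) : R :=
  joint_prob A (vertex_quantile A u) (vertex_quantile A v) /
  (vertex_prob A (vertex_quantile A u) * vertex_prob A (vertex_quantile A v)).

(* Sum over the first j vertices, so that breakpoint A 0 = 0. *)
Definition breakpoint (R : realType) (n : nat) (A : 'M[R]_n.+1) (j : nat) : R :=
  \sum_(x < n.+1 | (x < j)%N) vertex_prob A x.

(* Vertices start at 0, so the block of vertex j runs from breakpoint j to
   breakpoint j.+1. *)
Definition block_fun (R : realType) (n : nat) (A : 'M[R]_n.+1) (j : 'I_n.+1) :
    R -> R :=
  \1_(`]breakpoint A j, breakpoint A j.+1]).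

(* For each test index k, the first component of z is u and the second is v. *)
Definition estimating_equations (R : realType) (n : nat) (A : 'M[R]_n.+1)
    (alpha : 'cV[R]_n.+1) (lambda : R) : Prop :=
  forall k : 'I_n.+1,
    \sum_j alpha j 0 *
       (\int[(@lebesgue_measure R \x @lebesgue_measure R)%E]_(
            z in `[0%R, 1%R] `*` `[0%R, 1%R])
          ((grafield_kernel A z.1 z.2 - 1) * block_fun A j z.2 *
           block_fun A k z.1))
    - lambda * \sum_j alpha j 0 *
       (\int[@lebesgue_measure R]_(u in `[0%R, 1%R])
          (block_fun A j u * block_fun A k u)) = 0.

(* Main.v *)
Require Import Defs.
From HB Require Import structures.
From mathcomp Require Import all_boot all_order all_algebra.
From mathcomp Require Import all_classical all_reals all_analysis.
From mathcomp Require Import ring.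

(** The kernel and the basis are both adapted to one partition of ]0, 1]: the
    breakpoints u_0 < u_1 < ... cut it into half-open blocks, one for each
    vertex, the block of j having length p(j) (the whole of ]0, 1] is covered
    because the probabilities sum to 1, [last_breakpoint]).  On the block of j
    the quantile function is constantly j ([vertex_quantile_block]), so the
    kernel is constant on each rectangle of blocks, and every integrand of the
    estimating equations is a constant multiple of one indicator.  Each
    integral is therefore a constant times a measure ([Rintegral_cst_on]):
    the double integral is
      (P(k,j) / (p(k) p(j)) - 1) p(k) p(j) = P(k,j) - p(k) p(j),
    which is B(k,j) / N ([kernel_block_integral]), and the Gram matrix of the
    basis is diagonal with entries p(k) = d_k / N ([block_gram]).  The k-th
    estimating equation is thus 1 / N times the k-th row of
    B alpha - lambda D alpha = 0. *)

Set Implicit Arguments.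
Unset Strict Implicit.
Unset Printing Implicit Defensive.

Import Order.TTheory GRing.Theory Num.Theory.
Import numFieldNormedType.Exports.

Local Open Scope classical_set_scope.
Local Open Scope ring_scope.

(** On D such an f is the restriction to E of a constant, so its integral over
    D is that of the constant over E. *)
Lemma Rintegral_cst_on d (T : measurableType d) (R : realType)
    (mu : {measure set T -> \bar R}) (D E : set T) (f : T -> R) (c : R) :
    measurable E -> E `<=` D ->
    (forall x, D x -> f x = c * \1_E x) ->
  \int[mu]_(x in D) f x = c * fine (mu E).
Proof.
move=> mE ED fE; rewrite -(Rintegral_cst mu mE c) -{1}(setIidr ED).
rewrite Rintegral_mkcondr; apply: eq_Rintegral => x /set_mem Dx.
by rewrite fE// indicE patchE; case: (x \in E); rewrite ?mulr1 ?mulr0.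
Qed.

Lemma fine_lebesgue_itvoc (R : realType) (a b : R) : a <= b ->
  fine (@lebesgue_measure R `]a, b]) = b - a.
Proof.
move=> ab; rewrite lebesgue_measure_itv/= lte_fin.
by case: ltgtP ab => //= ->; rewrite subrr.
Qed.

Section Blocks.
Variables (R : realType) (n : nat) (A : 'M[R]_n.+1).
Hypothesis deg_gt0 : forall x, 0 < degree A x 0.

Lemma volumeE : volume A = \sum_x degree A x 0.
Proof. by apply: eq_bigr => x _; rewrite mxE. Qed.

Lemma volume_gt0 : 0 < volume A.
Proof.
rewrite volumeE big_ord_recl ltr_pwDl// sumr_ge0// => x _.
exact: ltW.
Qed.

Lemma vertex_prob_gt0 x : 0 < vertex_prob A x.
Proof. by rewrite divr_gt0// volume_gt0. Qed.

Lemma breakpointS (j : 'I_n.+1) :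
  breakpoint A j.+1 = breakpoint A j + vertex_prob A j.
Proof.
rewrite /breakpoint (bigD1 j)//= addrC; congr (_ + _).
by apply: eq_bigl => x; rewrite ltnS ltn_neqAle andbC.
Qed.

Lemma breakpoint_le i j : (i <= j)%N -> breakpoint A i <= breakpoint A j.
Proof.
move=> ij; rewrite /breakpoint big_mkcond [leRHS]big_mkcond/=.
apply: ler_sum => x _; case: ifPn => xi; first by rewrite (leq_trans xi ij).
by case: ifP => // _; rewrite ltW// vertex_prob_gt0.
Qed.

Lemma breakpoint_leS (j : 'I_n.+1) : breakpoint A j <= breakpoint A j.+1.
Proof. exact/breakpoint_le/leqnSn. Qed.

Lemma last_breakpoint : breakpoint A n.+1 = 1.
Proof.
rewrite /breakpoint (eq_bigl xpredT); last by move=> x; rewrite ltn_ord.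
by rewrite -mulr_suml -volumeE divff// gt_eqF// volume_gt0.
Qed.

Lemma block_sub01 (j : 'I_n.+1) :
  `]breakpoint A j, breakpoint A j.+1] `<=` `[0%R, 1%R].
Proof.
move=> u /=; rewrite !in_itv/= => /andP[ju uj]; apply/andP; split.
  rewrite (le_trans _ (ltW ju))// sumr_ge0// => x _.
  exact/ltW/vertex_prob_gt0.
by rewrite (le_trans uj)// -last_breakpoint breakpoint_le.
Qed.

(** The cumulative distribution at x is the right end of the block of x, so on
    the block of j the vertex j satisfies the defining condition of the
    quantile, while every smaller vertex has its block entirely to the left. *)
Lemma vertex_quantile_block (j : 'I_n.+1) (u : R) :
  u \in `]breakpoint A j, breakpoint A j.+1] -> vertex_quantile A u = j.
Proof.
rewrite in_itv/= => /andP[ju uj]; rewrite /vertex_quantile.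
have cdfE x : vertex_cdf A x = breakpoint A x.+1 by [].
case: arg_minP => [|i ui imin].
  by rewrite cdfE (le_trans uj)// breakpoint_le.
apply/le_anti/andP; split; first exact: imin.
rewrite leEord leqNgt; apply/negP => ij.
by have := lt_le_trans ju (le_trans ui (breakpoint_le ij)); rewrite ltxx.
Qed.

Lemma block_funE (j : 'I_n.+1) (u : R) :
  block_fun A j u = (u \in `]breakpoint A j, breakpoint A j.+1])%:R.
Proof. by rewrite /block_fun indicE mem_setE. Qed.

(** Two blocks that meet are equal, because the quantile function reads the
    vertex off any point of its block. *)
Lemma block_funM (j k : 'I_n.+1) (u : R) :
  block_fun A j u * block_fun A k u = (j == k)%:R * block_fun A k u.
Proof.
have [->|jk] := eqVneq j k.
  by rewrite mul1r block_funE -natrM mulnb andbb.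
rewrite mul0r !block_funE -natrM mulnb; case: andP => // -[uj uk].
by rewrite -(vertex_quantile_block uj) (vertex_quantile_block uk) eqxx in jk.
Qed.

Lemma block_length (j : 'I_n.+1) :
  fine (@lebesgue_measure R `]breakpoint A j, breakpoint A j.+1]) =
  vertex_prob A j.
Proof.
by rewrite fine_lebesgue_itvoc ?breakpoint_leS// breakpointS addrC addKr.
Qed.

Lemma block_gram (j k : 'I_n.+1) :
  \int[@lebesgue_measure R]_(u in `[0%R, 1%R])
     (block_fun A j u * block_fun A k u) = (j == k)%:R * vertex_prob A k.
Proof.
rewrite -block_length; apply: Rintegral_cst_on => //; first exact: block_sub01.
by move=> u _; rewrite block_funM.
Qed.

Lemma block_integral (j : 'I_n.+1) :
  \int[@lebesgue_measure R]_(u in `[0%R, 1%R]) block_fun A j u =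
  vertex_prob A j.
Proof.
rewrite -[RHS]mul1r -block_length; apply: Rintegral_cst_on => //.
  exact: block_sub01.
by move=> u _; rewrite mul1r.
Qed.

(** Division by p(k) p(j) in the kernel is undone by the area of the rectangle
    that carries the integrand. *)
Lemma kernel_block_integral (j k : 'I_n.+1) :
  \int[(@lebesgue_measure R \x @lebesgue_measure R)%E]_(
      z in `[0%R, 1%R] `*` `[0%R, 1%R])
     ((grafield_kernel A z.1 z.2 - 1) * block_fun A j z.2 * block_fun A k z.1)
  = (volume A)^-1 * modularity_mx A k j.
Proof.
pose I (i : 'I_n.+1) := [set` `]breakpoint A i, breakpoint A i.+1]].
have mI i : measurable (I i) by exact: measurable_itv.
have fin_I i : @lebesgue_measure R (I i) \is a fin_num.
  by rewrite /I lebesgue_measure_itv; case: ifP.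
transitivity ((joint_prob A k j / (vertex_prob A k * vertex_prob A j) - 1) *
  fine ((@lebesgue_measure R \x @lebesgue_measure R)%E (I k `*` I j)));
  last first.
- have -> :
      fine ((@lebesgue_measure R \x @lebesgue_measure R)%E (I k `*` I j)) =
      vertex_prob A k * vertex_prob A j.
    rewrite product_measure1E; [|exact: mI..].
    rewrite -!block_length; exact (fineM (fin_I k) (fin_I j)).
  rewrite !mxE big_ord1 !mxE /joint_prob /vertex_prob.
  have := volume_gt0; have := deg_gt0 j; have := deg_gt0 k.
  rewrite !mxE => /lt0r_neq0 dk /lt0r_neq0 dj /lt0r_neq0 N0.
  by field; rewrite N0 dj dk.
- apply: Rintegral_cst_on; first by apply: measurableX; apply: mI.
    by apply: setSX; apply: block_sub01.
  move=> [u v] _ /=.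
  have -> : \1_(I k `*` I j) (u, v) = block_fun A k u * block_fun A j v.
    by rewrite /block_fun !indicE in_setX -natrM mulnb.
  have [uk|/negbTE uk] := boolP (u \in `]breakpoint A k, breakpoint A k.+1]);
    last by rewrite [block_fun A k u]block_funE uk !(mulr0, mul0r).
  have [vj|/negbTE vj] := boolP (v \in `]breakpoint A j, breakpoint A j.+1]);
    last by rewrite [block_fun A j v]block_funE vj !(mulr0, mul0r).
  rewrite /grafield_kernel (vertex_quantile_block uk).
  rewrite (vertex_quantile_block vj).
  by rewrite -mulrA [block_fun A j v * _]mulrC.
Qed.

End Blocks.

Theorem theorem7 (R : realType) (n : nat) (A : 'M[R]_n.+1)
    (A_sym : A^T = A)
    (A_ge0 : forall x y, 0 <= A x y)
    (deg_gt0 : forall x, 0 < degree A x 0) :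
  (forall j : 'I_n.+1,
     \int[@lebesgue_measure R]_(u in `[0%R, 1%R]) block_fun A j u
       = vertex_prob A j /\
     \int[@lebesgue_measure R]_(u in `[0%R, 1%R]) (block_fun A j u ^+ 2)
       = vertex_prob A j) /\
  (forall (alpha : 'cV[R]_n.+1) (lambda : R),
     estimating_equations A alpha lambda <->
     modularity_mx A *m alpha = lambda *: (degree_mx A *m alpha)).
Proof.
split=> [j|alpha lambda].
  split; first exact: block_integral.
  under eq_Rintegral do rewrite expr2.
  by rewrite block_gram// eqxx mul1r.
have N0 : volume A != 0 by rewrite gt_eqF// volume_gt0.
have rowE k :
  \sum_j alpha j 0 *
     (\int[(@lebesgue_measure R \x @lebesgue_measure R)%E]_(
          z in `[0%R, 1%R] `*` `[0%R, 1%R])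
        ((grafield_kernel A z.1 z.2 - 1) * block_fun A j z.2 *
         block_fun A k z.1))
  - lambda * \sum_j alpha j 0 *
     (\int[@lebesgue_measure R]_(u in `[0%R, 1%R])
        (block_fun A j u * block_fun A k u)) =
  (volume A)^-1 * ((modularity_mx A *m alpha) k 0 -
                   (lambda *: (degree_mx A *m alpha)) k 0).
  under eq_bigr do rewrite kernel_block_integral//.
  under [X in _ - _ * X]eq_bigr do rewrite block_gram//.
  rewrite [X in _ - _ * X](bigD1 k)//= eqxx mul1r.
  rewrite [X in _ * (_ + X)]big1; last first.
    by move=> j /negbTE->; rewrite mul0r mulr0.
  rewrite /degree_mx mul_diag_mx addr0 mulrBr !mxE mulr_sumr; congr (_ - _).
    by apply: eq_bigr => j _; rewrite mulrCA [alpha j 0 * _]mulrC.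
  rewrite /vertex_prob !mxE; ring.
split=> [eqs|BD k].
- apply/matrixP => k i; rewrite [i]ord1; apply/eqP; rewrite -subr_eq0.
  by have /eqP := eqs k; rewrite rowE mulf_eq0 invr_eq0 (negbTE N0).
- by rewrite rowE BD subrr mulr0.
Qed.
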